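(* Let $K, L, M, N$ be positive integers with $K\le L<M$ and $L\le N$. Let $\Phi\in\mathbb{C}^{M\times N}$, and let $c\in\mathbb{C}^N$ be a $K$-sparse vector with support set $T=\operatorname{supp}(c)\subseteq\{1,\dots,N\}$ satisfying $$|c_i|\ \ge\ 3\delta\,\|c\|_2\qquad\text{for all } i\in T,$$ for some fixed constant $0<\delta\le \frac{1}{3\sqrt K}$. Let $A$ be a fixed constant with $1\le A<\sqrt L$, and assume that $\Phi$ satisfies the following properties (where $I\subseteq\{1,\dots,N\}$ and $I^c=\{1,\dots,N\}\setminus I$): \begin{align*} \|\Phi_{T_1}^*\Phi_{T_1}c_{T_1}\|_2 &\ge (1-\delta)^2\|c_{T_1}\|_2 && \text{for all } T_1\subseteq T,\\ \|\Phi_I\| &\le A && \text{for all } I \text{ with } |I|\le L,\\ \|\Phi_I^\dagger\| &\le A && \text{for all } I \text{ with } |I|\le L,\\ \|\Phi_I\Phi_I^\dagger\Phi_{I^c\cap T}\| &\le \delta/A && \text{for all } I \text{ with } |I|\le L. \end{align*} Then the Partial Inversion (PartInv) algorithm with parameter $L$, run on the noiseless input $y=\Phi c$, reconstructs the signal exactly in at most $K$ iterations; that is, its estimate satisfies $\hat c=c$ at the end of one of its first $K$ iterations.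
   Context: Notation. For an index set $I\subseteq\{1,\dots,N\}$, $\Phi_I$ is the submatrix of $\Phi$ consisting of the columns indexed by $I$, and $c_I\in\mathbb{C}^{|I|}$ is the vector of entries of $c$ indexed by $I$ (also identified, when convenient, with the vector in $\mathbb{C}^N$ equal to $c$ on $I$ and zero off $I$). $B^*$ is the adjoint of $B$; $\|\cdot\|_2$ is the Euclidean norm of a vector and $\|\cdot\|$ is the spectral (operator) norm of a matrix. $B^\dagger$ is the Moore–Penrose pseudoinverse, which equals $(B^*B)^{-1}B^*$ when $B$ has full column rank. A vector $c$ is $K$-sparse if it has $K$ nonzero entries, i.e. $\|c\|_0:=|\operatorname{supp}(c)|=K$. The PartInv algorithm with parameter $L$ (where $K\le L<M$), input $\Phi$ and $y$: Initialization: set $\hat c=\Phi^*y\in\mathbb{C}^N$ and let $I^{(0)}$ be the set of indices of the $L$ entries of $\hat c$ of largest magnitude. Iteration, for $k=0,1,2,\dots$ (the pass with index $k$ is the $(k+1)$-st iteration): (1) set $\hat c_{I^{(k)}}=\Phi_{I^{(k)}}^\dagger y$; (2) set $r=y-\Phi_{I^{(k)}}\hat c_{I^{(k)}}$; (3) set $J^{(k)}=\{1,\dots,N\}\setminus I^{(k)}$; (4) set $\hat c_{J^{(k)}}=\Phi_{J^{(k)}}^*r$; this together with (1) defines the new full estimate $\hat c\in\mathbb{C}^N$ of this iteration; (5) let $I^{(k+1)}$ be the set of indices of the $L$ entries of $\hat c$ of largest magnitude. Ties in selecting the $L$ largest magnitudes are broken arbitrarily. The iteration is repeated until a stopping condition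 is met; the claim concerns the sequence of estimates $\hat c$ produced by the iterations. *)

(* Defs.v *)
From HB Require Import structures.
From mathcomp Require Import all_boot all_order all_algebra.
From mathcomp Require Import boolp classical_sets reals.
From mathcomp Require Export complex.

Set Implicit Arguments.
Unset Strict Implicit.
Unset Printing Implicit Defensive.

Import Order.TTheory GRing.Theory Num.Theory.

Local Open Scope ring_scope.
Local Open Scope classical_set_scope.
Local Open Scope sesquilinear_scope.

Section Norms.
Variable R : realType.

Definition l2norm n (v : 'cV[R[i]]_n) : R :=
  Num.sqrt (\sum_i Normc.normc (v i 0) ^+ 2).

(* With the closed unit ball instead of the unit sphere, the supremum is over
   a nonempty set even when [n = 0]. *)
Definition opnorm m n (B : 'M[R[i]]_(m, n)) : R :=
  sup [set l2norm (B *m x) | x in [set x : 'cV[R[i]]_n | l2norm x <= 1]].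

Definition supp n (v : 'cV[R[i]]_n) : {set 'I_n} :=
  [set i | v i 0 != 0]%SET.

End Norms.

Section MoorePenrose.
Variable R : realType.

Definition penrose m n (B : 'M[R[i]]_(m, n)) (X : 'M[R[i]]_(n, m)) : Prop :=
  [/\ B *m X *m B = B, X *m B *m X = X,
      (B *m X) ^t* = B *m X & (X *m B) ^t* = X *m B].

(* [pinvmx] is not the Moore-Penrose pseudoinverse: it need not satisfy the
   last two Penrose conditions. *)
Definition mppinv m n (B : 'M[R[i]]_(m, n)) : 'M[R[i]]_(n, m) :=
  xget 0 [set X | penrose B X].

Lemma adjmxM m n p (A : 'M[R[i]]_(m, n)) (B : 'M[R[i]]_(n, p)) :
  (A *m B) ^t* = B ^t* *m A ^t*.
Proof. by rewrite trmx_mul map_mxM. Qed.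

Lemma adjmxV n (A : 'M[R[i]]_n) : (invmx A) ^t* = invmx (A ^t*).
Proof. by rewrite trmx_inv map_invmx. Qed.

Lemma penrose_unique m n (B : 'M[R[i]]_(m, n)) X Y :
  penrose B X -> penrose B Y -> X = Y.
Proof.
move=> [x1 x2 x3 x4] [y1 y2 y3 y4].
have E1 : B *m X = B *m Y.
  transitivity ((B *m Y *m (B *m X)) ^t*); first by rewrite mulmxA y1 x3.
  by rewrite adjmxM x3 y3 mulmxA x1.
have E2 : X *m B = Y *m B.
  transitivity ((X *m B *m (Y *m B)) ^t*).
    by rewrite -mulmxA [B *m _]mulmxA y1 x4.
  by rewrite adjmxM x4 y4 -mulmxA [B *m _]mulmxA x1.
by rewrite -x2 -mulmxA E1 mulmxA E2 y2.
Qed.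

Lemma gram_unit m n (A : 'M[R[i]]_(m, n)) : row_free A -> A *m A ^t* \in unitmx.
Proof.
move=> fA; rewrite -row_free_unit -kermx_eq0; apply/eqP/row_matrixP => i.
rewrite row0; set u := row i _.
have uG : u *m (A *m A ^t*) = 0.
  by rewrite /u -row_mul mulmx_ker row0.
apply/eqP; rewrite -(mulmx_free_eq0 u fA); apply: contraT => /dotmx_is_dotmx.
by rewrite dotmxE adjmxM mulmxA -(mulmxA u) uG mul0mx mxE ltxx.
Qed.

Lemma penrose_exists m n (B : 'M[R[i]]_(m, n)) : exists X, penrose B X.
Proof.
have := col_base_full B; have := row_base_free B; have := mulmx_base B.
move: (\rank B) (col_base B) (row_base B) => r C F /esym BE fF fC.
have GU : F *m F ^t* \in unitmx by exact: gram_unit.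
have HU : C ^t* *m C \in unitmx.
  rewrite -{2}(trmxCK C); apply: gram_unit.
  by rewrite /row_free mxrank_map mxrank_tr.
have GA : (F *m F ^t*) ^t* = F *m F ^t* by rewrite adjmxM trmxCK.
have HA : (C ^t* *m C) ^t* = C ^t* *m C by rewrite adjmxM trmxCK.
exists (F ^t* *m invmx (F *m F ^t*) *m invmx (C ^t* *m C) *m C ^t*).
set X := _ *m C ^t*.
have BX : B *m X = C *m invmx (C ^t* *m C) *m C ^t*.
  by rewrite BE /X !mulmxA -(mulmxA C F) mulmxK.
have XB : X *m B = F ^t* *m invmx (F *m F ^t*) *m F.
  by rewrite BE /X !mulmxA -(mulmxA _ (C ^t*) C) mulmxKV.
split.
- by rewrite BX BE !mulmxA -(mulmxA _ (C ^t*) C) mulmxKV.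
- by rewrite XB /X !mulmxA -(mulmxA _ F) mulmxKV.
- by rewrite BX !adjmxM trmxCK adjmxV HA mulmxA.
- by rewrite XB !adjmxM trmxCK adjmxV GA mulmxA.
Qed.

Lemma mppinvP m n (B : 'M[R[i]]_(m, n)) : penrose B (mppinv B).
Proof. by case: (penrose_exists B) => X; exact: xgetI. Qed.

Lemma mppinv_full_col_rank m n (B : 'M[R[i]]_(m, n)) :
  \rank B = n -> mppinv B = invmx (B ^t* *m B) *m B ^t*.
Proof.
move=> rB; have HU : B ^t* *m B \in unitmx.
  rewrite -{2}(trmxCK B); apply: gram_unit.
  by rewrite /row_free mxrank_map mxrank_tr rB.
apply: (penrose_unique (mppinvP B)); split.
- by rewrite -!mulmxA mulVmx // mulmx1.
- by rewrite -(mulmxA _ (B ^t*) B) mulVmx // mul1mx.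
- by rewrite !adjmxM adjmxV adjmxM trmxCK mulmxA.
- by rewrite -mulmxA mulVmx // trmx1 map_mx1.
Qed.

End MoorePenrose.

Section PartInv.
Variable R : realType.

(* [colsI I Phi] is the submatrix Phi_I and [rowsI I c] the vector c_I. *)
Definition colsI m n (I : {set 'I_n}) (Phi : 'M[R[i]]_(m, n)) :
  'M[R[i]]_(m, #|I|) := colsub (fun k : 'I_#|I| => enum_val k) Phi.

Definition rowsI n (I : {set 'I_n}) (c : 'cV[R[i]]_n) : 'cV[R[i]]_#|I| :=
  rowsub (fun k : 'I_#|I| => enum_val k) c.

(* Extension by zero off [I]. *)
Definition extend n (I : {set 'I_n}) (x : 'cV[R[i]]_#|I|) : 'cV[R[i]]_n :=
  \col_i \sum_(k | enum_val k == i) x k 0.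

Definition largest_indices n (L : nat) (v : 'cV[R[i]]_n) (I : {set 'I_n}) :
    Prop :=
  #|I| = L /\ forall i j, i \in I -> j \notin I ->
    Normc.normc (v j 0) <= Normc.normc (v i 0).

Definition partinv_estimate m n (Phi : 'M[R[i]]_(m, n)) (y : 'cV[R[i]]_m)
    (I : {set 'I_n}) : 'cV[R[i]]_n :=
  let cI := mppinv (colsI I Phi) *m y in
  let r := y - colsI I Phi *m cI in
  let J := (~: I)%SET in
  extend cI + extend ((colsI J Phi) ^t* *m r).

(* A relation, since ties between equal magnitudes are broken arbitrarily;
   [chat k] is the estimate at the end of the (k+1)-st iteration. *)
Definition partinv_run m n (L : nat) (Phi : 'M[R[i]]_(m, n))
    (y : 'cV[R[i]]_m) (I : nat -> {set 'I_n}) (chat : nat -> 'cV[R[i]]_n) :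
    Prop :=
  [/\ largest_indices L (Phi ^t* *m y) (I 0%N),
      forall k, chat k = partinv_estimate Phi y (I k) &
      forall k, largest_indices L (chat k) (I k.+1)].

Lemma largest_indices_exists n L (v : 'cV[R[i]]_n) :
  (L <= n)%N -> exists I, largest_indices L v I.
Proof.
elim: L => [_|L IH Ln]; first by exists finset.set0;
  split=> [|i j]; rewrite ?cards0 ?inE.
have [I [cI hI]] := IH (ltnW Ln).
have [i0 i0I] : exists i, i \notin I.
  have : (0 < #|~: I|)%N by rewrite cardsCs finset.setCK card_ord cI subn_gt0.
  by case/card_gt0P=> i; rewrite inE; exists i.
have [i iI im] :=
  @arg_maxP _ _ _ i0 (fun i => i \notin I) (fun i => Normc.normc (v i 0)) i0I.
exists (i |: I)%SET; split=> [|a b]; first by rewrite cardsU1 iI cI.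
rewrite !inE negb_or => /orP[/eqP-> | aI] /andP[_ bI]; first exact: im.
exact: hI.
Qed.

Lemma partinv_run_exists m n L (Phi : 'M[R[i]]_(m, n)) y :
  (L <= n)%N -> exists I chat, partinv_run L Phi y I chat.
Proof.
move=> Ln; have /choice[f fP] := fun v => @largest_indices_exists n L v Ln.
pose I := fix I k := if k is k'.+1 then f (partinv_estimate Phi y (I k'))
                     else f (Phi ^t* *m y).
by exists I, (fun k => partinv_estimate Phi y (I k)); split=> // k; exact: fP.
Qed.

End PartInv.

(* Main.v *)
Require Import Defs.
From mathcomp Require Import classical_sets reals.
From mathcomp Require Import all_boot all_order all_algebra.
From mathcomp Require Import complex ring lra.

Set Implicit Arguments.
Unset Strict Implicit.
Unset Printing Implicit Defensive.

Import Order.TTheory GRing.Theory Num.Theory.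

Local Open Scope ring_scope.
Local Open Scope sesquilinear_scope.

(** Let [S] be the part of the support [T] missed by the current index set [I],
    let [x] be the norm of [c] on [S], and let [P = B B^+] be the orthogonal
    projection onto the span of the columns of [Phi] indexed by [I].  Since
    [y = B c_I + phi] with [phi = Phi_S c_S], everything that spoils the
    estimate comes from [phi].

    - On [I], the estimate is [B^+ y = B^+ B c_I + B^+ phi].  The matrix [B]
      need not have full column rank, but no vector of its kernel has a nonzero
      entry in [T]: such an entry would put a column [Phi_t], [t] in [T], in the
      span of other columns, where the projection hypothesis makes it short,
      whereas the lower bound on the Gram matrix makes it long
      ([ker_colsI_supp]).  Hence [B^+ B c_I = c_I], and the error
      [B^+ phi = B^+ P phi] has norm at most [delta x]
      ([estimate_error_in]).
    - Off [I], the estimate is [Phi^* phi - Phi^* P phi].  Each of the two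
      terms is at most [delta x] in absolute value at an index outside [T]
      ([estimate_out_small]).  On [S] the first term has norm at least
      [(1 - delta)^2 x] and the second at most [delta^2 x], so that some entry
      in [S] has absolute value at least [(1 - 2 delta) x / sqrt #|S|]
      ([estimate_missed_large], [exists_large_entry]).

    Thus all entries outside [T] are at most [2 delta x].  The entries in
    [T :&: I] are at least [3 delta |c| - delta x], hence larger, and these
    indices stay selected.  As soon as one index of [T] has been found,
    [#|S| <= K - 1], and [(1 + sqrt (K - 1))^2 <= 2 K] then gives
    [1 - 2 delta > 2 delta sqrt #|S|] ([sparsity_margin]), so that a new index
    of [S] is selected too.  The initial correlation [Phi^* y] is at most
    [delta |c|] outside [T] and at least [(1 - delta)^2 |c| / sqrt K >= 3 delta
    (1 - delta)^2 |c|] somewhere in [T], so the initial set already holds one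
    index of [T].  Each pass adds at least one, and once [T] is contained in
    [I] the bounds above, with [x = 0], say that the estimate is [c]. *)

(** * Euclidean and operator norms *)

Section EuclideanNorm.
Variable R : realType.
Implicit Types (m n : nat) (z : R[i]).

Definition vdot n (u v : 'cV[R[i]]_n) : R[i] := (u ^t* *m v) 0 0.

Lemma normcEC z : `|z| = (Normc.normc z)%:C%C.
Proof. by []. Qed.

Lemma normc_ge0 z : 0 <= Normc.normc z.
Proof. by rewrite -ler0c -normcEC. Qed.

Lemma sqr_l2norm n (v : 'cV[R[i]]_n) :
  l2norm v ^+ 2 = \sum_i Normc.normc (v i 0) ^+ 2.
Proof. by rewrite sqr_sqrtr // sumr_ge0 // => i _; rewrite sqr_ge0. Qed.

Lemma l2norm_ge0 n (v : 'cV[R[i]]_n) : 0 <= l2norm v.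
Proof. exact: sqrtr_ge0. Qed.

Lemma vdotvv n (v : 'cV[R[i]]_n) : vdot v v = (l2norm v ^+ 2)%:C%C.
Proof.
rewrite sqr_l2norm /vdot mxE rmorph_sum; apply: eq_bigr => i _ /=.
by rewrite !mxE mulrC -normCK normcEC rmorphXn.
Qed.

(** Cauchy-Schwarz inequality, transferred from the form [dotmx] on row
    vectors. *)
Lemma normc_vdot n (u v : 'cV[R[i]]_n) :
  Normc.normc (vdot u v) <= l2norm u * l2norm v.
Proof.
rewrite -(@ler_pXn2r _ 2) ?nnegrE ?mulr_ge0 ?l2norm_ge0 ?normc_ge0 //.
have [+ _] := CauchySchwarz (@dotmx R[i] n) (u ^t*) (v ^t*).
rewrite /= !dotmxE !trmxCK -[X in `|X|]/(vdot u v) -[X in X * _]/(vdot u u).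
rewrite -[X in _ * X]/(vdot v v) !vdotvv normcEC -rmorphXn -rmorphM lecR.
by rewrite exprMn.
Qed.

Lemma normc_le_l2norm n (v : 'cV[R[i]]_n) k : Normc.normc (v k 0) <= l2norm v.
Proof.
rewrite -(@ler_pXn2r _ 2) ?nnegrE ?l2norm_ge0 ?normc_ge0 //.
rewrite sqr_l2norm (bigD1 k) //= lerDl sumr_ge0 // => i _.
by rewrite sqr_ge0.
Qed.

Lemma l2norm0 n : l2norm (0 : 'cV[R[i]]_n) = 0.
Proof.
apply/eqP; rewrite -sqrf_eq0 sqr_l2norm big1 // => i _.
by rewrite mxE Normc.normc0 expr0n.
Qed.

Lemma l2norm_eq0 n (v : 'cV[R[i]]_n) : l2norm v = 0 -> v = 0.
Proof.
move=> v0; apply/matrixP => i j; rewrite ord1 mxE.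
apply: Normc.eq0_normc; apply/eqP; rewrite eq_le normc_ge0 andbT.
by rewrite -v0 normc_le_l2norm.
Qed.

Lemma l2normZ n z (v : 'cV[R[i]]_n) :
  l2norm (z *: v) = Normc.normc z * l2norm v.
Proof.
apply/eqP; rewrite -(@eqrXn2 _ 2) ?mulr_ge0 ?l2norm_ge0 ?normc_ge0 //.
rewrite exprMn !sqr_l2norm mulr_sumr; apply/eqP/eq_bigr => i _.
by rewrite mxE Normc.normcM exprMn.
Qed.

Lemma l2normD n (u v : 'cV[R[i]]_n) : l2norm (u + v) <= l2norm u + l2norm v.
Proof.
rewrite -(@ler_pXn2r _ 2) ?nnegrE ?addr_ge0 ?l2norm_ge0 //.
have E : (l2norm (u + v) ^+ 2)%:C%C =
    (l2norm u ^+ 2)%:C%C + (l2norm v ^+ 2)%:C%C + (vdot u v + vdot v u).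
  rewrite -!vdotvv /vdot !mxE -!big_split; apply: eq_bigr => i _ /=.
  rewrite !mxE rmorphD /=; ring.
rewrite -lecR -[leLHS]ger0_norm ?ler0c ?sqr_ge0 // E.
apply: le_trans (ler_normD _ _) _.
apply: le_trans (lerD (ler_normD _ _) (ler_normD _ _)) _.
rewrite ![`|(_ ^+ 2)%:C%C|]ger0_norm ?ler0c ?sqr_ge0 // !normcEC -!rmorphD lecR.
rewrite sqrrD mulr2n addrAC lerD2r lerD2l lerD ?normc_vdot //.
by rewrite mulrC normc_vdot.
Qed.

Lemma l2norm_sum n (J : finType) (f : J -> 'cV[R[i]]_n) :
  l2norm (\sum_j f j) <= \sum_j l2norm (f j).
Proof.
elim/big_ind2 : _ => [|a x b y ha hb|//]; first by rewrite l2norm0.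
exact: le_trans (l2normD _ _) (lerD ha hb).
Qed.

Lemma vdot_adj m n (B : 'M[R[i]]_(m, n)) u v :
  vdot u (B *m v) = vdot (B ^t* *m u) v.
Proof. by rewrite /vdot adjmxM trmxCK mulmxA. Qed.

(** The sum of the norms of the columns bounds the image of the unit ball;
    without a bound [sup] would be a junk value and [opnorm] would control
    nothing. *)
Lemma opnorm_has_ub m n (B : 'M[R[i]]_(m, n)) :
  has_ubound
    [set l2norm (B *m x) | x in [set x : 'cV[R[i]]_n | l2norm x <= 1]]%classic.
Proof.
exists (\sum_j l2norm (col j B)) => _ [x /= x1 <-].
have -> : B *m x = \sum_j x j 0 *: col j B.
  apply/matrixP => i j; rewrite ord1 summxE mxE; apply: eq_bigr => k _.
  by rewrite !mxE mulrC.
apply: le_trans (l2norm_sum _) (ler_sum _ _) => j _.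
rewrite l2normZ ler_piMl ?l2norm_ge0 //.
exact: le_trans (normc_le_l2norm _ _) x1.
Qed.

Lemma opnorm_ge0 m n (B : 'M[R[i]]_(m, n)) : 0 <= opnorm B.
Proof.
apply: ub_le_sup (opnorm_has_ub B) _ _; exists 0.
  by rewrite /= l2norm0 ler01.
by rewrite mulmx0 l2norm0.
Qed.

Lemma l2norm_mulmx m n (B : 'M[R[i]]_(m, n)) a x :
  opnorm B <= a -> l2norm (B *m x) <= a * l2norm x.
Proof.
move=> Ba; have [/l2norm_eq0 -> | x0] := eqVneq (l2norm x) 0.
  by rewrite mulmx0 !l2norm0 mulr0.
have xp : 0 < l2norm x by rewrite lt_def x0 l2norm_ge0.
rewrite -ler_pdivrMr // mulrC; apply: le_trans Ba.
have nV : Normc.normc ((l2norm x)^-1)%:C%C = (l2norm x)^-1.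
  by apply: complexI; rewrite -normcEC ger0_norm // ler0c invr_ge0 ltW.
rewrite -{1}nV -l2normZ scalemxAr; apply: ub_le_sup (opnorm_has_ub B) _ _.
exists (((l2norm x)^-1)%:C%C *: x) => //=.
by rewrite l2normZ nV mulVf.
Qed.

(** A matrix and its adjoint have the same norm: [|B^* w|^2 = <w, B B^* w>] is at
    most [|w| |B| |B^* w|]. *)
Lemma l2norm_adj_mulmx m n (B : 'M[R[i]]_(m, n)) a w :
  opnorm B <= a -> l2norm (B ^t* *m w) <= a * l2norm w.
Proof.
move=> Ba; have [->|w0] := eqVneq (l2norm (B ^t* *m w)) 0.
  by rewrite mulr_ge0 ?l2norm_ge0 // (le_trans (opnorm_ge0 B)).
have wp : 0 < l2norm (B ^t* *m w) by rewrite lt_def w0 l2norm_ge0.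
rewrite -(ler_pM2r wp) -expr2 mulrAC mulrC.
have -> : l2norm (B ^t* *m w) ^+ 2 = Normc.normc (vdot w (B *m (B ^t* *m w))).
  apply: complexI; rewrite vdot_adj vdotvv -normcEC ger0_norm //.
  by rewrite ler0c sqr_ge0.
apply: le_trans (normc_vdot _ _) _.
by rewrite ler_wpM2l ?l2norm_ge0 // l2norm_mulmx.
Qed.
End EuclideanNorm.

(** * Restriction to an index set *)

Section Restriction.
Variables (R : realType) (n : nat).
Implicit Types (I : {set 'I_n}) (v : 'cV[R[i]]_n).

(** The zero-extended form of [c_I]: products with submatrices of [Phi] become
    products with [Phi] itself, which removes the dependent index types. *)
Definition restr I v : 'cV[R[i]]_n := \col_i (if i \in I then v i 0 else 0).

Lemma rowsIE I v (k : 'I_#|I|) : rowsI I v k 0 = v (enum_val k) 0.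
Proof. by rewrite mxE. Qed.

Lemma colsI_rowsI m I (Phi : 'M[R[i]]_(m, n)) v :
  colsI I Phi *m rowsI I v = Phi *m restr I v.
Proof.
apply/matrixP => i j; rewrite ord1 !mxE.
under [RHS]eq_bigr do rewrite mxE (fun_if ( *%R _)) mulr0.
rewrite -big_mkcond [RHS]big_enum_val /=.
by apply: eq_bigr => k _; rewrite !mxE.
Qed.

Lemma colsI_adj m I (Phi : 'M[R[i]]_(m, n)) w :
  (colsI I Phi) ^t* *m w = rowsI I (Phi ^t* *m w).
Proof.
by apply/matrixP => i j; rewrite !mxE; apply: eq_bigr => k _; rewrite !mxE.
Qed.

Lemma l2norm_rowsI I v : l2norm (rowsI I v) = l2norm (restr I v).
Proof.
congr Num.sqrt; under eq_bigr do rewrite rowsIE.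
rewrite -(big_enum_val (fun i => Normc.normc (v i 0) ^+ 2)) /= big_mkcond.
apply: eq_bigr => i _ /=; rewrite mxE; case: ifP => // _.
by rewrite Normc.normc0 expr0n.
Qed.

Lemma normc_le_l2norm_rowsI I v i :
  i \in I -> Normc.normc (v i 0) <= l2norm (rowsI I v).
Proof.
move=> iI; rewrite l2norm_rowsI.
by have := normc_le_l2norm (restr I v) i; rewrite mxE iI.
Qed.

Lemma extend_in I (x : 'cV[R[i]]_#|I|) k : extend x (enum_val k) 0 = x k 0.
Proof.
by rewrite mxE (big_pred1 k) // => l; rewrite (inj_eq enum_val_inj).
Qed.

Lemma extend_notin I (x : 'cV[R[i]]_#|I|) i : i \notin I -> extend x i 0 = 0.
Proof.
move=> iI; rewrite mxE big_pred0 // => k; apply: contraNF iI => /eqP <-.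
exact: enum_valP.
Qed.

Lemma rowsI_extend I (x : 'cV[R[i]]_#|I|) : rowsI I (extend x) = x.
Proof. by apply/matrixP => k j; rewrite ord1 rowsIE extend_in. Qed.

Lemma restr_id I v : (forall i, i \notin I -> v i 0 = 0) -> restr I v = v.
Proof.
move=> h; apply/matrixP => i j; rewrite ord1 mxE.
by case: ifPn => // /h.
Qed.

Lemma restr_restr I J v : restr I (restr J v) = restr (I :&: J) v.
Proof.
by apply/matrixP => i j; rewrite !mxE inE; case: (i \in I).
Qed.

Lemma restr_split I v : v = restr I v + restr (~: I) v.
Proof.
apply/matrixP => i j; rewrite ord1 !mxE inE.
by case: (i \in I); rewrite ?addr0 ?add0r.
Qed.

Lemma l2norm_restr_lt I v i :
  i \notin I -> v i 0 != 0 -> l2norm (restr I v) < l2norm v.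
Proof.
move=> iI vi; rewrite -(@ltr_pXn2r _ 2) ?nnegrE ?l2norm_ge0 // !sqr_l2norm.
rewrite (bigD1 i) //= [ltRHS](bigD1 i) //= mxE (negPf iI).
rewrite Normc.normc0 expr0n /= ltr_leD ?exprn_gt0 //.
  rewrite lt_def normc_ge0 andbT.
  by apply: contraNneq vi => /Normc.eq0_normc ->.
rewrite ler_sum // => j _; rewrite mxE.
by case: ifP => // _; rewrite Normc.normc0 expr0n sqr_ge0.
Qed.

(** Of [#|I|] entries, the largest is at least their root mean square. *)
Lemma exists_large_entry I v : (0 < #|I|)%N ->
  exists2 s, s \in I &
    l2norm (rowsI I v) <= Num.sqrt #|I|%:R * Normc.normc (v s 0).
Proof.
case/card_gt0P=> i0 i0I.
have [s sI sm] := @Order.TotalTheory.arg_maxP _ _ _ i0 (fun i => i \in I)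
  (fun i => Normc.normc (v i 0)) i0I.
exists s => //.
rewrite -(@ler_pXn2r _ 2) ?nnegrE ?mulr_ge0 ?l2norm_ge0 ?normc_ge0 //;
  rewrite ?sqrtr_ge0 //.
rewrite sqr_l2norm exprMn sqr_sqrtr ?ler0n // mulr_natl -[X in _ *+ X]card_ord.
rewrite -sumr_const ler_sum // => k _; rewrite rowsIE.
by rewrite lerXn2r ?nnegrE ?normc_ge0 //; apply: sm; exact: enum_valP.
Qed.
End Restriction.

(** * The projection onto a column space *)

Section Projection.
Variables (R : realType) (m n : nat) (B : 'M[R[i]]_(m, n)).

Definition colproj : 'M[R[i]]_m := B *m mppinv B.

Lemma colproj_adj : colproj ^t* = colproj.
Proof. by have [] := mppinvP B. Qed.

Lemma colproj_idem (w : 'cV[R[i]]_m) : colproj *m (colproj *m w) = colproj *m w.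
Proof. by have [BXB _ _ _] := mppinvP B; rewrite /colproj !mulmxA BXB. Qed.

Lemma colproj_id : colproj *m B = B.
Proof. by have [] := mppinvP B. Qed.

Lemma mppinv_colproj : mppinv B *m colproj = mppinv B.
Proof. by have [_ XBX _ _] := mppinvP B; rewrite mulmxA. Qed.

Lemma adj_colproj (w : 'cV[R[i]]_m) : B ^t* *m (colproj *m w) = B ^t* *m w.
Proof. by rewrite mulmxA -{1}colproj_adj -adjmxM colproj_id. Qed.

(** [B^+ B] is the orthogonal projection onto the orthogonal complement of the
    kernel of [B], even when the columns of [B] are dependent. *)
Lemma mppinvK_orth_ker (x : 'cV[R[i]]_n) :
  (forall w : 'cV[R[i]]_n, B *m w = 0 -> vdot w x = 0) ->
  mppinv B *m (B *m x) = x.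
Proof.
move=> h; have [BXB XBX _ aXB] := mppinvP B.
pose w := x - mppinv B *m (B *m x).
have Bw : B *m w = 0 by rewrite /w mulmxBr !mulmxA BXB subrr.
apply/esym/eqP; rewrite -subr_eq0 -/w; apply/eqP/l2norm_eq0/eqP.
rewrite -sqrf_eq0 -(inj_eq (@complexI R)) -vdotvv {2}/w /vdot mulmxBr mxE.
rewrite -[X in X + _]/(vdot w x) h // mxE [mppinv B *m _]mulmxA -aXB.
by rewrite mulmxA -adjmxM -mulmxA Bw mulmx0 trmx0 map_mx0 mul0mx mxE subrr.
Qed.
End Projection.

(** * One pass of partial inversion *)

Section PartialInversionStep.
Variables (R : realType) (M N L : nat) (Phi : 'M[R[i]]_(M, N)).
Variables (c : 'cV[R[i]]_N) (T : {set 'I_N}) (delta A : R).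
Hypothesis L_gt0 : (0 < L)%N.
Hypothesis c_supp : forall i, (c i 0 != 0) = (i \in T).
Hypothesis delta_gt0 : 0 < delta.
Hypothesis delta_le : delta <= 3^-1.
Hypothesis A_ge1 : 1 <= A.
Hypothesis gram_lower : forall T1 : {set 'I_N}, T1 \subset T ->
  (1 - delta) ^+ 2 * l2norm (rowsI T1 c)
  <= l2norm ((colsI T1 Phi) ^t* *m colsI T1 Phi *m rowsI T1 c).
Hypothesis cols_norm : forall I : {set 'I_N}, (#|I| <= L)%N ->
  opnorm (colsI I Phi) <= A.
Hypothesis pinv_norm : forall I : {set 'I_N}, (#|I| <= L)%N ->
  opnorm (mppinv (colsI I Phi)) <= A.
Hypothesis proj_norm : forall I : {set 'I_N}, (#|I| <= L)%N ->
  opnorm (colsI I Phi *m mppinv (colsI I Phi) *m colsI (~: I :&: T) Phi)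
  <= delta / A.
Implicit Types (I : {set 'I_N}) (v : 'cV[R[i]]_N) (i j : 'I_N).

Let A_gt0 : 0 < A. Proof. exact: lt_le_trans A_ge1. Qed.

Let mulA_divA x : A * (delta / A * x) = delta * x.
Proof. by rewrite mulrA mulrCA divff ?mulr1 // gt_eqF. Qed.

Lemma card_set1_le i : (#|[set i]%SET| <= L)%N. Proof. by rewrite cards1. Qed.

Lemma l2norm_colproj_mul I v : (#|I| <= L)%N ->
  l2norm (colproj (colsI I Phi) *m (Phi *m restr (~: I :&: T) v))
  <= delta / A * l2norm (restr (~: I :&: T) v).
Proof.
move=> IL; rewrite -colsI_rowsI -l2norm_rowsI mulmxA.
exact: l2norm_mulmx (proj_norm IL).
Qed.

Lemma normc_corr_le i w : Normc.normc ((Phi ^t* *m w) i 0) <= A * l2norm w.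
Proof.
apply: le_trans (l2norm_adj_mulmx w (cols_norm (card_set1_le i))).
by rewrite colsI_adj normc_le_l2norm_rowsI ?set11.
Qed.

(** The projection hypothesis for the single column [j]: as [Phi_j^* P = Phi_j^*]
    when [P] projects onto that column, the correlation sees only the projection
    of a combination of columns in [T], which is short. *)
Lemma normc_cross_corr_le j v : j \notin T ->
  Normc.normc ((Phi ^t* *m (Phi *m restr T v)) j 0)
  <= delta * l2norm (restr T v).
Proof.
move=> jT; pose I := [set j]%SET.
have IT : (~: I :&: T = T)%SET.
  by apply/setIidPr/subsetP => t tT; rewrite !inE; apply: contraNneq jT => <-.
have -> : (Phi ^t* *m (Phi *m restr T v)) j 0 =
    (Phi ^t* *m (colproj (colsI I Phi) *m (Phi *m restr T v))) j 0.
  have jI : j \in I by rewrite set11.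
  pose k := enum_rank_in jI j.
  have <- : enum_val k = j by rewrite enum_rankK_in.
  by rewrite -!(rowsIE (I := I)) -!colsI_adj adj_colproj.
apply: le_trans (normc_corr_le _ _) _.
have := l2norm_colproj_mul v (card_set1_le j); rewrite IT => h.
apply: le_trans (ler_wpM2l (ltW A_gt0) h) _.
by rewrite mulA_divA.
Qed.

Lemma restrTc : restr T c = c.
Proof. by apply: restr_id => i; rewrite -c_supp negbK => /eqP. Qed.

(** If a kernel vector supported on [I] had a nonzero entry at [t] in [T], then
    [Phi_t] would be a combination of the columns in [I :\ t].  It would be
    fixed by the projection onto their span, so [|Phi_t c_t| <= delta / A |c_t|]
    and [|Phi_t^* Phi_t c_t| <= delta |c_t|], which is below
    [(1 - delta)^2 |c_t|] because [delta <= 1/3]. *)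
Lemma ker_colsI_supp I v t : (#|I| <= L)%N -> Phi *m restr I v = 0 ->
  t \in I -> t \in T -> v t 0 = 0.
Proof.
move=> IL v0 tI tT; apply/eqP/negPn/negP => vt.
have ct : c t 0 != 0 by rewrite c_supp.
(* Scaled so that its entry at [t] is that of [c]. *)
pose u := (c t 0 / v t 0) *: v; pose d := restr [set t] c.
pose I' := (I :\ t)%SET.
have I'L : (#|I'| <= L)%N.
  by rewrite (leq_trans _ IL) // subset_leq_card // subD1set.
have Phid : Phi *m d = - (Phi *m restr I' u).
  apply/eqP; rewrite -subr_eq0 opprK -mulmxDr; apply/eqP.
  have -> : d + restr I' u = (c t 0 / v t 0) *: restr I v.
    apply/matrixP => i j; rewrite ord1 !mxE !inE.
    have [->|it] := eqVneq i t; first by rewrite tI /= addr0 divfK.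
    by rewrite add0r /=; case: ifP; rewrite ?mulr0.
  by rewrite -scalemxAr v0 scaler0.
have dE : restr (~: I' :&: T) d = d.
  apply: restr_id => i; rewrite !inE mxE inE; case: eqVneq => [->|//].
  by rewrite tT.
have := l2norm_colproj_mul d I'L; rewrite dE.
have -> : colproj (colsI I' Phi) *m (Phi *m d) = Phi *m d.
  by rewrite Phid -colsI_rowsI mulmxN mulmxA colproj_id.
move=> Pd; have := gram_lower (T1 := [set t]%SET); rewrite sub1set => /(_ tT).
apply/negP; rewrite -ltNge -mulmxA colsI_rowsI -/d l2norm_rowsI -/d.
apply: le_lt_trans (l2norm_adj_mulmx _ (cols_norm (card_set1_le t))) _.
apply: le_lt_trans (ler_wpM2l (ltW A_gt0) Pd) _.
rewrite mulA_divA ltr_pM2r; last first.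
  rewrite lt_def l2norm_ge0 andbT; apply: contraNneq ct => /l2norm_eq0 d0.
  by move/matrixP: d0 => /(_ t 0); rewrite !mxE set11 => ->.
by move: delta_gt0 delta_le; nra.
Qed.

Section Step.
Variable I : {set 'I_N}.
Hypothesis IL : (#|I| <= L)%N.
Let S := (~: I :&: T)%SET.
Let missed := l2norm (restr S c).
Let est := partinv_estimate Phi (Phi *m c) I.
Let B := colsI I Phi.
Let phi := Phi *m restr S c.

(** A kernel vector of [B] vanishes on [T] while [c] vanishes off [T], so [c_I] is
    orthogonal to the kernel of [B] even when [B] is rank deficient. *)
Lemma mppinv_colsI_recovers : mppinv B *m (B *m rowsI I c) = rowsI I c.
Proof.
apply: mppinvK_orth_ker => w Bw; rewrite /vdot mxE big1 // => k _.
rewrite !mxE; have [kT|kT] := boolP (enum_val k \in T).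
  have := @ker_colsI_supp I (extend w) (enum_val k) IL _ (enum_valP k) kT.
  by rewrite -colsI_rowsI rowsI_extend extend_in => ->; rewrite ?conjC0 ?mul0r.
by move: kT; rewrite -c_supp negbK => /eqP ->; rewrite mulr0.
Qed.

Lemma measurement_split : Phi *m c = B *m rowsI I c + phi.
Proof.
rewrite colsI_rowsI -mulmxDr /S -restr_restr restrTc.
by rewrite -restr_split.
Qed.

Lemma l2norm_colproj_missed : l2norm (colproj B *m phi) <= delta / A * missed.
Proof. exact: l2norm_colproj_mul. Qed.

Lemma colsI_pinv_measurement :
  mppinv B *m (Phi *m c) = rowsI I c + mppinv B *m (colproj B *m phi).
Proof.
by rewrite measurement_split mulmxDr mppinv_colsI_recovers mulmxA mppinv_colproj.
Qed.

Lemma residual_eq :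
  Phi *m c - B *m (mppinv B *m (Phi *m c)) = phi - colproj B *m phi.
Proof.
rewrite [B *m _]mulmxA -/(colproj B) measurement_split mulmxDr mulmxA colproj_id.
by rewrite opprD addrACA subrr add0r.
Qed.

Lemma estimate_in (k : 'I_#|I|) :
  est (enum_val k) 0 = c (enum_val k) 0 + (mppinv B *m (colproj B *m phi)) k 0.
Proof.
rewrite /est /partinv_estimate -/B mxE extend_in extend_notin; last first.
  by rewrite inE negbK enum_valP.
by rewrite addr0 colsI_pinv_measurement mxE rowsIE.
Qed.

Lemma estimate_out j : j \notin I ->
  est j 0 = (Phi ^t* *m phi) j 0 - (Phi ^t* *m (colproj B *m phi)) j 0.
Proof.
move=> jI; have jC : j \in (~: I)%SET by rewrite inE.
rewrite /est /partinv_estimate -/B mxE extend_notin // add0r residual_eq.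
pose k := enum_rank_in jC j; have <- : enum_val k = j by rewrite enum_rankK_in.
by rewrite extend_in colsI_adj rowsIE mulmxBr !mxE.
Qed.

Lemma estimate_error_in i : i \in I ->
  Normc.normc (est i 0 - c i 0) <= delta * missed.
Proof.
move=> iI; pose k := enum_rank_in iI i.
have <- : enum_val k = i by rewrite enum_rankK_in.
rewrite estimate_in addrAC subrr add0r.
apply: le_trans (normc_le_l2norm _ _) _.
apply: le_trans (l2norm_mulmx _ (pinv_norm IL)) _.
apply: le_trans (ler_wpM2l (ltW A_gt0) l2norm_colproj_missed) _.
by rewrite mulA_divA.
Qed.

Lemma estimate_out_small j : j \notin I -> j \notin T ->
  Normc.normc (est j 0) <= 2 * delta * missed.
Proof.
move=> jI jT; rewrite estimate_out // -mulrA mulr2n mulrDl mul1r.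
apply: le_trans (le_normcD _ _) (lerD _ _).
  have ST : restr T (restr S c) = restr S c.
    by rewrite restr_restr /S setICA setIid.
  by have := normc_cross_corr_le (restr S c) jT; rewrite ST.
rewrite normcN; apply: le_trans (normc_corr_le _ _) _.
apply: le_trans (ler_wpM2l (ltW A_gt0) l2norm_colproj_missed) _.
by rewrite mulA_divA.
Qed.

(** The correlation of [Phi_S] with [phi] is large by the lower bound on the Gram
    matrix.  The correction [Phi_S^* P phi = (P Phi_S)^* (P phi)] is small of
    second order because the projection hypothesis applies to both factors; a
    bound [delta x] would not leave enough room in the detection step. *)
Lemma estimate_missed_large : (1 - 2 * delta) * missed <= l2norm (rowsI S est).
Proof.
have -> : rowsI S est =
    (colsI S Phi) ^t* *m phi - (colsI S Phi) ^t* *m (colproj B *m phi).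
  apply/matrixP => k j; rewrite ord1 rowsIE estimate_out; last first.
    by have := enum_valP k; rewrite !inE => /andP[].
  by rewrite !colsI_adj !mxE.
have h1 : (1 - delta) ^+ 2 * missed <= l2norm ((colsI S Phi) ^t* *m phi).
  have := gram_lower (subsetIr (~: I)%SET T).
  by rewrite l2norm_rowsI -mulmxA colsI_rowsI.
have h2 : l2norm ((colsI S Phi) ^t* *m (colproj B *m phi))
    <= delta ^+ 2 * missed.
  have -> : (colsI S Phi) ^t* *m (colproj B *m phi) =
      (colproj B *m colsI S Phi) ^t* *m (colproj B *m phi).
    by rewrite adjmxM colproj_adj -mulmxA colproj_idem.
  apply: le_trans (l2norm_adj_mulmx _ (proj_norm IL)) _.
  have dA : 0 <= delta / A <= delta.
    rewrite divr_ge0 ?(ltW A_gt0) ?(ltW delta_gt0) //=.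
    by rewrite ler_pdivrMr // ler_peMr // ltW.
  case/andP: dA => dA0 dA1.
  apply: le_trans (ler_wpM2l dA0 l2norm_colproj_missed) _.
  by rewrite mulrA ler_wpM2r ?l2norm_ge0 // expr2 ler_pM.
have -> : 1 - 2 * delta = (1 - delta) ^+ 2 - delta ^+ 2 by ring.
rewrite mulrBl lerBlDr; apply: le_trans h1 _.
set a := (colsI S Phi) ^t* *m phi; set b := _ *m (_ *m phi) in h2 *.
have := l2normD (a - b) b; rewrite subrK => /le_trans; apply.
by rewrite lerD2l.
Qed.

Lemma estimate_spurious_small j : j \notin T ->
  Normc.normc (est j 0) <= 2 * delta * missed.
Proof.
move=> jT; have [jI|jI] := boolP (j \in I); last exact: estimate_out_small.
have := estimate_error_in jI; move: (jT); rewrite -c_supp negbK => /eqP ->.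
rewrite subr0 => /le_trans; apply; rewrite -mulrA mulr2n mulrDl mul1r lerDl.
by rewrite mulr_ge0 ?l2norm_ge0 // ltW.
Qed.

Lemma estimate_exact : T \subset I -> est = c.
Proof.
move=> TI; have missed0 : missed = 0.
  rewrite /missed; have -> : S = set0.
    by apply/eqP; rewrite /S setIC -setDE setD_eq0.
  have -> : restr set0 c = 0 by apply/matrixP => i j; rewrite !mxE inE.
  exact: l2norm0.
apply/matrixP => i j; rewrite ord1; apply/eqP; rewrite -subr_eq0; apply/eqP.
apply: Normc.eq0_normc; apply/eqP; rewrite eq_le normc_ge0 andbT.
have [iI|iI] := boolP (i \in I).
  by have := estimate_error_in iI; rewrite missed0 mulr0.
have iT : i \notin T by apply: contra iI; apply/subsetP.
have := estimate_out_small iI iT; rewrite missed0 mulr0.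
by move: iT; rewrite -c_supp negbK => /eqP ->; rewrite subr0.
Qed.

End Step.

End PartialInversionStep.

(** * Selection of the largest entries and detection margin *)

Section Selection.
Variable R : realType.

(** If [s] were left out, all [L] selected entries would be at least as large as
    the one at [s], hence would lie in [T] without [s], which has fewer than [L]
    elements. *)
Lemma largest_indices_mem n L (v : 'cV[R[i]]_n) (I T : {set 'I_n}) s :
  largest_indices L v I -> (#|T| <= L)%N -> s \in T ->
  (forall j, j \notin T -> Normc.normc (v j 0) < Normc.normc (v s 0)) ->
  s \in I.
Proof.
move=> [cI hI] TL sT big_s; apply: contraLR TL => sI; rewrite -ltnNge -cI.
apply: proper_card; apply/properP; split; last by exists s.
apply/subsetP => i iI; apply: contraT => /big_s.
by rewrite ltNge hI.
Qed.

(** [(1 + sqrt n)^2 <= 2 (n + 1) <= 2 K], hence [2 (1 + sqrt n) < 3 sqrt K] as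
    [8 < 9].  With [n = K] in place of [n < K] the inequality fails for small
    [K], and the first detection must be argued separately. *)
Lemma sparsity_margin (delta : R) K n : (n < K)%N -> 0 < delta ->
  delta <= 1 / (3 * Num.sqrt K%:R) -> 2 * delta * Num.sqrt n%:R < 1 - 2 * delta.
Proof.
move=> nK d0; have K0 : 0 < Num.sqrt K%:R :> R.
  by rewrite sqrtr_gt0 ltr0n (leq_ltn_trans _ nK).
rewrite ler_pdivlMr ?mulr_gt0 // => h.
have hn : 0 <= Num.sqrt n%:R :> R by exact: sqrtr_ge0.
have sn : Num.sqrt n%:R ^+ 2 + 1 <= Num.sqrt K%:R ^+ 2 :> R.
  by rewrite !sqr_sqrtr ?ler0n // natr1 ler_nat.
move: h K0 hn sn; set t := Num.sqrt K%:R; set w := Num.sqrt n%:R => h K0 hn sn.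
have tw : 2 * (1 + w) < 3 * t.
  rewrite -(@ltr_pXn2r _ 2) ?nnegrE //; try lra.
  have := sqr_ge0 (1 - w); nra.
have : delta * (2 * (1 + w)) < delta * (3 * t) by rewrite ltr_pM2l.
lra.
Qed.
End Selection.

(** * Exact recovery *)

Theorem theorem3p1 (R : realType) (K L M N : nat)
    (Phi : 'M[R[i]]_(M, N)) (c : 'cV[R[i]]_N) (T : {set 'I_N})
    (delta A : R) (y : 'cV[R[i]]_M)
    (hK0 : (0 < K)%N) (hL0 : (0 < L)%N) (hM0 : (0 < M)%N) (hN0 : (0 < N)%N)
    (hKL : (K <= L)%N) (hLM : (L < M)%N) (hLN : (L <= N)%N)
    (hT : T = supp c) (hK : #|T| = K)
    (hdelta0 : 0 < delta) (hdelta : delta <= 1 / (3 * Num.sqrt K%:R))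
    (hc : forall i, i \in T -> 3 * delta * l2norm c <= Normc.normc (c i 0))
    (hA1 : 1 <= A) (hAL : A < Num.sqrt L%:R)
    (hlower : forall T1 : {set 'I_N}, T1 \subset T ->
       (1 - delta) ^+ 2 * l2norm (rowsI T1 c)
       <= l2norm ((colsI T1 Phi) ^t* *m colsI T1 Phi *m rowsI T1 c))
    (hnorm : forall I : {set 'I_N}, (#|I| <= L)%N ->
       opnorm (colsI I Phi) <= A)
    (hpinv : forall I : {set 'I_N}, (#|I| <= L)%N ->
       opnorm (mppinv (colsI I Phi)) <= A)
    (hproj : forall I : {set 'I_N}, (#|I| <= L)%N ->
       opnorm (colsI I Phi *m mppinv (colsI I Phi) *m colsI (~: I :&: T) Phi)
       <= delta / A)
    (hy : y = Phi *m c)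
    (I : nat -> {set 'I_N}) (chat : nat -> 'cV[R[i]]_N)
    (hrun : partinv_run L Phi y I chat) :
  exists k : nat, (k < K)%N /\ chat k = c.
Proof.
subst y; have [run0 runE runS] := hrun.
have c_supp i : (c i 0 != 0) = (i \in T) by rewrite hT inE.
have sqrtK : 1 <= Num.sqrt K%:R :> R by rewrite -{1}sqrtr1 ler_wsqrtr // ler1n.
have d3 : 3 * (delta * Num.sqrt K%:R) <= 1.
  have : 0 < 3 * Num.sqrt K%:R :> R by lra.
  by move/ler_pdivlMr => e; move: hdelta; rewrite e mulrCA.
have delta_le : delta <= 3^-1 by nra.
have TL : (#|T| <= L)%N by rewrite hK.
have cardI k : (#|I k| <= L)%N.
  by case: k => [|k]; [case: run0 => -> | case: (runS k) => ->].
have normT i : i \in T -> 0 < Normc.normc (c i 0).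
  rewrite -c_supp => ci; rewrite lt_def normc_ge0 andbT.
  by apply: contraNneq ci => /Normc.eq0_normc ->.
have c_gt0 : 0 < l2norm c.
  have /card_gt0P[t /normT tT] : (0 < #|T|)%N by rewrite hK.
  exact: lt_le_trans tT (normc_le_l2norm _ _).
have est_in :=
  estimate_error_in hL0 c_supp hdelta0 delta_le hA1 hlower hnorm hpinv hproj.
have est_spurious :=
  estimate_spurious_small hL0 c_supp hdelta0 delta_le hA1 hlower hnorm hpinv
    hproj.
have exact_est :=
  estimate_exact hL0 c_supp hdelta0 delta_le hA1 hlower hnorm hpinv hproj.
have est_large := estimate_missed_large c_supp hdelta0 hA1 hlower hproj.
have [/existsP[k Tk]|noT] := boolP [exists k : 'I_K, T \subset I k].
  exists k; split=> //; rewrite runE.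
  exact: exact_est Tk.
(* By [noT] no pass before the [K]-th starts from a set containing [T]. *)
suff grow k : (k < K)%N -> (k < #|T :&: I k|)%N.
  have kK : (K.-1 < K)%N by rewrite prednK.
  have := grow _ kK; rewrite prednK // => le_card.
  case/negP: noT; apply/existsP; exists (Ordinal kK) => /=.
  by apply/setIidPl/eqP; rewrite eqEcard subsetIl hK.
elim: k => [_|k IH kK].
  (* The cross-correlations off [T] are at most [delta |c|], whereas some entry
     in [T] exceeds this because [(1 - delta)^2 >= 4/9 > sqrt K * delta]. *)
  have T_gt0 : (0 < #|T|)%N by rewrite hK.
  have [s sT sbig] := exists_large_entry (Phi ^t* *m (Phi *m c)) T_gt0.
  apply/card_gt0P; exists s; rewrite inE sT /=.
  apply: (largest_indices_mem run0 TL sT) => j jT.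
  have := normc_cross_corr_le hL0 hA1 hnorm hproj c jT.
  rewrite (restrTc c_supp) => /le_lt_trans -> //.
  have low := hlower T (subxx _); rewrite l2norm_rowsI (restrTc c_supp) in low.
  rewrite -mulmxA colsI_adj colsI_rowsI (restrTc c_supp) in low.
  have := le_trans low sbig; rewrite hK => big_s.
  have : (1 - delta) ^+ 2 * l2norm c > Num.sqrt K%:R * (delta * l2norm c).
    by rewrite mulrA ltr_pM2r // mulrC; nra.
  move=> /lt_le_trans /(_ big_s); rewrite ltr_pM2l //.
  exact: lt_le_trans ltr01 sqrtK.
have k'K : (k < K)%N by exact: ltnW.
set S := ~: I k :&: T; set x := l2norm (restr S c).
have S_gt0 : (0 < #|S|)%N.
  rewrite card_gt0; apply: contraNneq noT => S0; apply/existsP.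
  by exists (Ordinal k'K); rewrite /= -setD_eq0 setDE setIC -/S S0.
have card_S : (#|S| < K)%N.
  rewrite -hK -(cardsID (I k) T) setDE [T :&: ~: _]setIC -/S.
  rewrite -{1}[#|S|]add0n ltn_add2r.
  exact: leq_ltn_trans (IH k'K).
have x_gt0 : 0 < x.
  have [t tS] := card_gt0P S_gt0.
  have tT : t \in T by move: tS; rewrite inE => /andP[].
  apply: lt_le_trans (normT t tT) _.
  by rewrite /x -l2norm_rowsI normc_le_l2norm_rowsI.
have spurious j : j \notin T -> Normc.normc (chat k j 0) <= 2 * delta * x.
  by rewrite runE; exact: est_spurious.
have [s sS sbig] := exists_large_entry (chat k) S_gt0.
have sT : s \in T by move: sS; rewrite inE => /andP[].
(* Detection: the largest missed entry exceeds all spurious ones. *)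
have new_s : s \in I k.+1.
  apply: (largest_indices_mem (runS k) TL sT) => j /spurious.
  move/le_lt_trans; apply.
  have := est_large _ (cardI k); rewrite -runE -/S -/x.
  move=> /le_trans /(_ sbig) big_s.
  have := sparsity_margin card_S hdelta0 hdelta.
  rewrite -(ltr_pM2r x_gt0) => /lt_le_trans /(_ big_s).
  by rewrite mulrAC mulrC ltr_pM2l // sqrtr_gt0 ltr0n.
(* Retention: found entries are at least [3 delta |c| - delta x > 2 delta x], the
   inequality being strict because [c] has a nonzero entry outside [S]. *)
have kept : T :&: I k \subset T :&: I k.+1.
  apply/subsetP => i; rewrite !inE => /andP[iT iI]; rewrite iT /=.
  apply: (largest_indices_mem (runS k) TL iT) => j /spurious.
  move/le_lt_trans; apply.
  have err := est_in _ (cardI k) i iI; rewrite -runE -/S -/x in err.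
  have x_lt : x < l2norm c.
    by apply: (l2norm_restr_lt (i := i)); rewrite ?c_supp // !inE iI.
  have := le_normcD (chat k i 0) (c i 0 - chat k i 0); rewrite addrC subrK.
  rewrite -[_ (c i 0 - _)]normcN opprB => tri.
  have := hc i iT; nra.
have sk : s \notin T :&: I k.
  by move: sS; rewrite !inE => /andP[/negPf -> _]; rewrite andbF.
apply: leq_ltn_trans (IH k'K) _; apply: proper_card; apply/properP; split=> //.
by exists s => //; rewrite inE sT new_s.
Qed.
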